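(* Let $G$ be a connected finite simple graph with $n$ vertices and $m$ edges, and let ${\bf P}$ be the transition probability matrix of the correlated random walk on $G$ with respect to the Grover matrix. Choose one arc $e_j$ ($1\le j\le m$) for each edge of $G$, so that $D(G)=\{e_1,\ldots,e_m,e_1^{-1},\ldots,e_m^{-1}\}$. Then, as an identity of rational functions in $u$, $$\det({\bf I}_{2m}-u{\bf P})=\prod_{j=1}^m\left(1-u^2\left(\frac{4}{d_{o(e_j)}}-1\right)\left(\frac{4}{d_{t(e_j)}}-1\right)\right)\det({\bf I}_n-u{\bf A}_{CRW}+u^2{\bf D}_{CRW}),$$ where ${\bf A}_{CRW}$ and ${\bf D}_{CRW}$ are the $n\times n$ matrices indexed by $V(G)$ given by $$({\bf A}_{CRW})_{xy}=\begin{cases}\dfrac{4/d_x^2}{1-u^2(4/d_x-1)(4/d_y-1)} & \text{if }(x,y)\in D(G),\\ 0&\text{otherwise,}\end{cases}$$ $$({\bf D}_{CRW})_{xy}=\begin{cases}\displaystyle\sum_{o(e)=x}\frac{(4/d_x^2)(4/d_{t(e)}-1)}{1-u^2(4/d_x-1)(4/d_{t(e)}-1)} & \text{if }x=y,\\ 0&\text{otherwise,}\end{cases}$$ the sum being over arcs $e\in D(G)$ with $o(e)=x$.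
   Context: For a finite simple graph $G$, $D(G)=\{(u,v),(v,u)\mid uv\in E(G)\}$ is its set of arcs. For $e=(u,v)\in D(G)$, write $o(e)=u$, $t(e)=v$, $e^{-1}=(v,u)$. The degree of $v$ is $d_v=\deg v$. With $m$ edges, $|D(G)|=2m$. The Grover matrix of $G$ is the $2m\times 2m$ matrix ${\bf U}=(U_{ef})_{e,f\in D(G)}$ with $U_{ef}=2/d_{t(f)}$ if $t(f)=o(e)$ and $f\ne e^{-1}$; $U_{ef}=2/d_{t(f)}-1$ if $f=e^{-1}$; and $U_{ef}=0$ otherwise. The transition probability matrix of the correlated random walk (CRW) on $G$ with respect to the Grover matrix is ${\bf P}=(P_{ef})_{e,f\in D(G)}$ with $P_{ef}=|U_{ef}|^2$. ${\bf I}_k$ is the $k\times k$ identity matrix. *)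

(* Defs.v *)
(* MathComp, without analysis: the identity is purely algebraic. *)
From mathcomp Require Import all_boot all_order all_algebra.

Set Implicit Arguments.
Unset Strict Implicit.
Unset Printing Implicit Defensive.

Import Order.TTheory GRing.Theory Num.Theory.
Local Open Scope ring_scope.

Record sgraph := SGraph {
  vertex :> finType;
  adj : rel vertex;
  adj_sym : symmetric adj;
  adj_irrefl : irreflexive adj }.

Definition connected_graph (G : sgraph) := forall x y : G, connect (@adj G) x y.

Definition deg (G : sgraph) (x : G) : nat := #|[set y | adj x y]|.

Definition edge_set (G : sgraph) : {set {set G}} :=
  [set [set p.1; p.2] | p : G * G & adj p.1 p.2].

Definition dart (G : sgraph) : predArgType := {p : G * G | adj p.1 p.2}.

Definition org (G : sgraph) (e : dart G) : G := (val e).1.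
Definition ter (G : sgraph) (e : dart G) : G := (val e).2.

Fact dart_inv_subproof (G : sgraph) (e : dart G) :
  adj (ter e, org e).1 (ter e, org e).2.
Proof. by rewrite /= adj_sym; exact: (valP e). Qed.

Definition dart_inv (G : sgraph) (e : dart G) : dart G :=
  exist _ (ter e, org e) (dart_inv_subproof e).

Definition dart_edge (G : sgraph) (e : dart G) : {set G} := [set org e; ter e].

Lemma dart_inv_neq (G : sgraph) (e : dart G) : dart_inv e != e.
Proof.
apply/eqP => /(congr1 val) /= h; have := valP e; rewrite -[val e]h /=.
by move: (congr1 snd h) => /= ->; rewrite adj_irrefl.
Qed.

Lemma dart_edge_eq (G : sgraph) (e f : dart G) :
  (dart_edge f == dart_edge e) = (f \in [set e; dart_inv e]).
Proof.
rewrite !inE; apply/eqP/orP => [h|[]/eqP->]; last 2 first.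
- by [].
- by rewrite /dart_edge setUC.
have ne (g : dart G) : org g != ter g.
  by apply/eqP => gE; have := valP g; rewrite -/(org g) -/(ter g) gE adj_irrefl.
have := set21 (org f) (ter f); have := set22 (org f) (ter f).
rewrite -/(dart_edge f) h !inE; have := ne f.
case: e f {h} => [[a b] /= eP] [[c d] /= fP]; rewrite /org /ter /= -!val_eqE /=.
rewrite !xpair_eqE.
by move=> cd /orP[]/eqP dE /orP[]/eqP cE; subst; rewrite ?eqxx ?orbT in cd *;
  [ | right | left | ].
Qed.

Lemma card_dart (G : sgraph) : #|dart G| = (#|edge_set G|.*2)%N.
Proof.
have -> : edge_set G = [set dart_edge e | e : dart G].
  apply/setP => f; apply/imsetP/imsetP => [[p pP ->]|[e _ ->]].
    by rewrite inE in pP; exists (exist _ p pP).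
  by exists (val e) => //; rewrite inE; exact: (valP e).
rewrite -[#|dart G|]sum1_card (partition_big_imset (@dart_edge G)) /=.
rewrite -muln2 -sum_nat_const.
apply: eq_bigr => _ /imsetP[e _ ->].
rewrite sum1_card -[RHS](_ : #|[set e; dart_inv e]| = 2%N).
  by apply: eq_card => f; rewrite -dart_edge_eq.
by rewrite cards2 eq_sym dart_inv_neq.
Qed.

(* With m = #|edge_set G|, every edge carries exactly one of the arcs a 0, ...,
   a (m-1), so these together with their inverses are all the arcs. *)
Definition orientation (G : sgraph) (a : 'I_#|edge_set G| -> dart G) :=
  forall f : {set G}, f \in edge_set G -> exists! j, dart_edge (a j) = f.

(* Matrices indexed by a finite type, using its canonical enumeration. *)
Definition index_mx (I : finType) (K : Type) (F : I -> I -> K) : 'M[K]_#|I| :=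
  \matrix_(i, j) F (enum_val i) (enum_val j).

Section Walk.
Variables (R : numFieldType) (G : sgraph).

Definition grover (e f : dart G) : R :=
  if (ter f == org e) && (f != dart_inv e) then 2 / (deg (ter f))%:R
  else if f == dart_inv e then 2 / (deg (ter f))%:R - 1
  else 0.

Definition grover_mx : 'M[R]_#|dart G| := index_mx grover.

Definition crw_mx : 'M[R]_#|dart G| := map_mx (fun z => `|z| ^+ 2) grover_mx.
End Walk.

(* These are meant for u = 'X in a field of rational functions, where every
   denominator 1 - u ^+ 2 * c with c constant is nonzero. *)
Section CRWMatrices.
Variables (K : fieldType) (G : sgraph) (u : K).

Definition A_CRW : 'M[K]_#|G| := index_mx (fun x y : G =>
  if adj x y then (4 / (deg x)%:R ^+ 2) /
    (1 - u ^+ 2 * (4 / (deg x)%:R - 1) * (4 / (deg y)%:R - 1))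
  else 0).

Definition D_CRW : 'M[K]_#|G| := index_mx (fun x y : G =>
  if x == y then
    \sum_(e : dart G | org e == x)
      ((4 / (deg x)%:R ^+ 2) * (4 / (deg (ter e))%:R - 1)) /
      (1 - u ^+ 2 * (4 / (deg x)%:R - 1) * (4 / (deg (ter e))%:R - 1))
  else 0).
End CRWMatrices.

Definition ratfun (R : numFieldType) : fieldType := {fraction {poly R}}.
Definition ratfunC (R : numFieldType) (c : R) : ratfun R := tofrac c%:P.
Definition ratfunX (R : numFieldType) : ratfun R := tofrac 'X.

(* Main.v *)
Require Import Defs.
From HB Require Import structures.
From mathcomp Require Import all_boot all_order all_algebra.
From mathcomp Require Import perm ring.

Set Implicit Arguments.
Unset Strict Implicit.
Unset Printing Implicit Defensive.

Import Order.TTheory GRing.Theory Num.Theory.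
Local Open Scope ring_scope.

(** Put c x = 4/d_x - 1 and w x = 4/d_x^2. Squaring the entries of the Grover
matrix gives (2/d - 1)^2 = 4/d^2 - (4/d - 1), hence P = B W C - J, where
B e x = [o(e) = x], C x f = [t(f) = x], W is the diagonal matrix of w, and
J e f = c (o e) [f = e^-1] is a weighted version of arc reversal
([crw_mxE]). In other words, 1 - u P = M - u B W C with M = 1 + u J: a matrix
that only couples each arc to its inverse, corrected by a matrix that factors
through the vertices.

The matrix M splits into one 2 x 2 block per edge, with ones on the diagonal,
u c (o e) and u c (t e) off it, and determinant
1 - u^2 c (o e) c (t e). Its determinant is therefore the product in the
theorem ([det_backtrack]), and its inverse N is explicit
([mul_backtrack_inv]). Since

  det (M - u B W C) = det M * det (1 - u W C N B)

([det_sub_mulmx]), only the vertex-indexed matrix W C N B remains. Its entry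
at (x, y) sums over the arcs e ending at x; the diagonal part of N retains
those that start at y, which yields A_CRW, and the reversing part of N returns
to x, which yields - u D_CRW ([backtrack_inv_vertex]). This computation works
over any field for arbitrary vertex weights c and w as long as the edge
determinants do not vanish ([det_weighted_walk]). In the field of rational
functions they do not vanish, because each takes the value 1 at u = 0. *)

(** * Determinants of sums and products *)

Lemma det_block_mx_schurl (R : comPzRingType) (m n : nat)
    (X : 'M[R]_(m, n)) (Y : 'M_(n, m)) :
  \det (block_mx 1%:M X Y 1%:M) = \det (1%:M - Y *m X).
Proof.
have -> : block_mx 1%:M X Y 1%:M =
    block_mx 1%:M 0 Y 1%:M *m block_mx 1%:M X 0 (1%:M - Y *m X).
  rewrite mulmx_block !mulmx0 !mul0mx !mulmx1 !mul1mx !addr0.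
  by rewrite addrC subrK.
by rewrite det_mulmx det_lblock det_ublock !det1 !mul1r.
Qed.

(** Sylvester's identity: the block matrix with identity diagonal blocks has
the two Schur complements 1 - Y X and 1 - X Y. *)
Lemma det_sub1_mulmxC (R : comPzRingType) (m n : nat)
    (X : 'M[R]_(m, n)) (Y : 'M_(n, m)) :
  \det (1%:M - X *m Y) = \det (1%:M - Y *m X).
Proof.
rewrite -(det_block_mx_schurl X Y).
have -> : block_mx 1%:M X Y 1%:M =
    block_mx (1%:M - X *m Y) X 0 1%:M *m block_mx 1%:M 0 Y 1%:M.
  by rewrite mulmx_block !mulmx0 !mul0mx !mulmx1 !mul1mx !add0r subrK.
by rewrite det_mulmx det_lblock det_ublock !det1 !mulr1.
Qed.

Lemma det_sub_mulmx (R : comPzRingType) (m n : nat)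
    (M N : 'M[R]_m) (B : 'M_(m, n)) (C : 'M_(n, m)) :
  M *m N = 1%:M ->
  \det (M - B *m C) = \det M * \det (1%:M - C *m N *m B).
Proof.
move=> MN; rewrite -mulmxA -det_sub1_mulmxC -det_mulmx.
by rewrite mulmxBr mulmx1 !mulmxA MN mul1mx.
Qed.

(** * Matrices indexed by finite types *)

(** The rectangular form of [index_mx]: arc-by-vertex matrices are needed to
factor through the vertices. *)
Definition fin_mx (I J : finType) (K : Type) (F : I -> J -> K) :
    'M[K]_(#|I|, #|J|) :=
  \matrix_(i, j) F (enum_val i) (enum_val j).

Lemma mul_fin_mx (I J L : finType) (R : pzSemiRingType)
    (F : I -> J -> R) (H : J -> L -> R) :
  fin_mx F *m fin_mx H = fin_mx (fun i l => \sum_j F i j * H j l).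
Proof.
apply/matrixP => i l; rewrite !mxE.
rewrite [RHS](reindex (@enum_val J predT)) /=; last first.
  exact/onW_bij/enum_val_bij.
by apply: eq_bigr => j _; rewrite !mxE.
Qed.

Lemma fin_mx1 (I : finType) (R : pzSemiRingType) :
  fin_mx (fun i j : I => (i == j)%:R) = 1%:M :> 'M[R]_#|I|.
Proof. by apply/matrixP => i j; rewrite !mxE (inj_eq enum_val_inj). Qed.

(** A determinant does not depend on how the index type is enumerated, since a
change of enumeration permutes rows and columns alike and the two signs
cancel. *)
Lemma det_index_mx_reindex (R : comPzRingType) (J : finType) (N : nat)
    (h : 'I_N -> J) (F : J -> J -> R) :
  injective h -> N = #|J| ->
  \det (index_mx F) = \det (\matrix_(i, j) F (h i) (h j)).
Proof.
move=> h_inj NE; subst N.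
have s_inj : injective (fun i => enum_rank (h i)).
  by move=> i j /enum_rank_inj/h_inj.
pose s := perm s_inj.
have -> : (\matrix_(i, j) F (h i) (h j)) =
    row_perm s (col_perm s (index_mx F)).
  by apply/matrixP => i j; rewrite !mxE !permE !enum_rankK.
rewrite row_permE col_permE !det_mulmx !det_perm odd_permV.
by rewrite [X in _ * X]mulrC mulrA -expr2 sqrr_sign mul1r.
Qed.

(** * Arcs and orientations *)

Section Darts.
Variable G : sgraph.
Implicit Types e f : dart G.

Lemma dart_invK : involutive (@dart_inv G).
Proof. by case=> [[x y] xy]; apply: val_inj. Qed.

Lemma orgV e : org (dart_inv e) = ter e. Proof. by []. Qed.
Lemma terV e : ter (dart_inv e) = org e. Proof. by []. Qed.

Lemma eq_dart e f : (e == f) = (org e == org f) && (ter e == ter f).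
Proof. by rewrite -val_eqE -xpair_eqE /org /ter -!surjective_pairing. Qed.

(** In a simple graph at most one arc goes from y to x. *)
Lemma sum_dart (V : nmodType) (x y : G) (F : dart G -> V) (c : V) :
  (forall e, ter e = x -> org e = y -> F e = c) ->
  \sum_(e : dart G | (ter e == x) && (org e == y)) F e =
    if adj x y then c else 0.
Proof.
move=> Fc; case: ifPn => [|/negP xyN].
  rewrite adj_sym => yx; pose e0 : dart G := exist _ (y, x) yx.
  rewrite (big_pred1 e0) ?Fc // => e.
  by rewrite /= eq_dart andbC.
rewrite big_pred0 // => e; apply/negP => /andP[/eqP ex /eqP ey].
by apply: xyN; rewrite adj_sym -ex -ey; exact: (valP e).
Qed.

Section Orientation.
Variable a : 'I_#|edge_set G| -> dart G.
Hypothesis a_or : orientation a.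

(** The enumeration e_1, ..., e_m, e_1^-1, ..., e_m^-1 of the arcs. *)
Definition oriented_dart (i : 'I_(#|edge_set G| + #|edge_set G|)) : dart G :=
  match split i with inl j => a j | inr j => dart_inv (a j) end.

Lemma orientation_edge_inj : injective (fun j => dart_edge (a j)).
Proof.
move=> j k jk; have ak_edge : dart_edge (a k) \in edge_set G.
  by apply/imsetP; exists (val (a k)) => //; rewrite inE; exact: (valP (a k)).
have [l [_ l_uniq]] := a_or ak_edge.
by rewrite -(l_uniq _ jk) -(l_uniq k).
Qed.

Lemma oriented_dart_inj : injective oriented_dart.
Proof.
have edgeV e : dart_edge (dart_inv e) = dart_edge e by rewrite /dart_edge setUC.
move=> i k; rewrite /oriented_dart -{2}(splitK i) -{2}(splitK k).
case: (split i) (split k) => [j|j] [l|l] /= eq_jl;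
  have jl := congr1 (@dart_edge G) eq_jl;
  rewrite ?edgeV in jl; move/orientation_edge_inj: jl eq_jl => -> eq_ll //.
- by have := dart_inv_neq (a l); rewrite -eq_ll eqxx.
- by have := dart_inv_neq (a l); rewrite eq_ll eqxx.
Qed.

End Orientation.
End Darts.

(** * The determinant of a weighted walk on arcs *)

Section WeightedWalk.
Variables (K : fieldType) (G : sgraph) (u : K) (c w : G -> K).
Implicit Types e f : dart G.

Definition edge_den e : K := 1 - u ^+ 2 * c (org e) * c (ter e).

Definition backtrack e f : K :=
  (e == f)%:R + (f == dart_inv e)%:R * (u * c (org e)).

(** On the pair e, e^-1 the matrix [backtrack] is a 2 x 2 block with
determinant [edge_den e]; this is its adjugate divided by that determinant. *)
Definition backtrack_inv e f : K :=
  ((e == f)%:R - (f == dart_inv e)%:R * (u * c (org e))) / edge_den e.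

Lemma edge_denV e : edge_den (dart_inv e) = edge_den e.
Proof. by rewrite /edge_den orgV terV; ring. Qed.

Lemma sum_backtrack e (s t : K) (F : dart G -> K) :
  \sum_f ((e == f)%:R * s + (f == dart_inv e)%:R * t) * F f =
    s * F e + t * F (dart_inv e).
Proof.
under eq_bigr => f _ do rewrite mulrDl.
rewrite big_split /= (bigD1 e) //= eqxx mul1r big1 => [|f /negPf fe]; last first.
  by rewrite eq_sym fe !mul0r.
rewrite (bigD1 (dart_inv e)) //= eqxx mul1r big1 ?addr0 // => f /negPf fe.
by rewrite fe !mul0r.
Qed.

Lemma mul_backtrack_inv :
  (forall e, edge_den e != 0) ->
  fin_mx backtrack *m fin_mx backtrack_inv = 1%:M.
Proof.
move=> den_neq0; rewrite mul_fin_mx -fin_mx1; apply/matrixP => i j.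
rewrite !mxE; move: (enum_val i) (enum_val j) => e g.
under eq_bigr => f _ do rewrite /backtrack -[(e == f)%:R]mulr1.
rewrite sum_backtrack /backtrack_inv edge_denV dart_invK orgV mul1r.
have := den_neq0 e; rewrite [g == e]eq_sym [dart_inv e == g]eq_sym /edge_den.
by move=> h; field.
Qed.

(** Listing the arcs as e_1, ..., e_m, e_1^-1, ..., e_m^-1 turns the matrix into
a block matrix with identity diagonal blocks and diagonal off-diagonal blocks
X and Y, so its determinant is that of the diagonal matrix 1 - Y X. *)
Lemma det_backtrack (a : 'I_#|edge_set G| -> dart G) :
  orientation a ->
  \det (index_mx backtrack) = \prod_(j < #|edge_set G|) edge_den (a j).
Proof.
move=> a_or; have h_inj := oriented_dart_inj a_or.
rewrite (det_index_mx_reindex _ h_inj) ?card_dart ?addnn //.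
pose X := diag_mx (\row_j (u * c (org (a j)))).
pose Y := diag_mx (\row_j (u * c (ter (a j)))).
have a_inj : injective a.
  by move=> j k jk; apply: (orientation_edge_inj a_or); rewrite jk.
have a_neqV j k : (a j == dart_inv (a k)) = false.
  apply/eqP => jk; suff /h_inj/eqP : oriented_dart a (lshift _ j) =
      oriented_dart a (rshift _ k) by rewrite eq_lrshift.
  by rewrite /oriented_dart (unsplitK (inl j)) (unsplitK (inr k)).
have -> : (\matrix_(i, j) backtrack (oriented_dart a i) (oriented_dart a j)) =
    block_mx 1%:M X Y 1%:M.
  apply/matrixP => i j; rewrite -(splitK i) -(splitK j) !mxE /oriented_dart.
  rewrite !unsplitK; case: (split i) (split j) => [k|k] [l|l] /=;
    rewrite ?(unsplitK (inl _)) ?(unsplitK (inr _)) ?mxE;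
    rewrite ?(unsplitK (inl _)) ?(unsplitK (inr _)) ?mxE /backtrack ?dart_invK;
    rewrite ?(inj_eq (can_inj (@dart_invK G))) ?(inj_eq a_inj).
  - by rewrite a_neqV mul0r addr0.
  - by rewrite a_neqV add0r mulr_natl eq_sym.
  - by rewrite eq_sym a_neqV add0r mulr_natl eq_sym.
  - by rewrite [_ == a k]eq_sym a_neqV mul0r addr0.
rewrite det_block_mx_schurl mulmx_diag -diag_const_mx -linearB /= det_diag.
by apply: eq_bigr => j _; rewrite !mxE /edge_den; ring.
Qed.

Definition weighted_A : 'M[K]_#|G| := index_mx (fun x y : G =>
  if adj x y then w x / (1 - u ^+ 2 * c x * c y) else 0).

Definition weighted_D : 'M[K]_#|G| := index_mx (fun x y : G =>
  if x == y then
    \sum_(e : dart G | org e == x)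
      (w x * c (ter e)) / (1 - u ^+ 2 * c x * c (ter e))
  else 0).

(** The walk seen from the vertices. The diagonal part of [backtrack_inv]
counts a step from x to an adjacent y, and its reversing part a step to a
neighbour and back, which is why the second term is diagonal. *)
Lemma backtrack_inv_vertex :
  fin_mx (fun (x : G) e => (ter e == x)%:R * (u * w x)) *m fin_mx backtrack_inv
     *m fin_mx (fun e (y : G) => (org e == y)%:R) =
  u *: weighted_A - u ^+ 2 *: weighted_D.
Proof.
rewrite -mulmxA !mul_fin_mx; apply/matrixP => i j; rewrite !mxE.
move: (enum_val i) (enum_val j) => x y.
(* A row of [backtrack_inv] has only two nonzero entries, at e and at e^-1. *)
under eq_bigr => e _.
  rewrite [X in _ * X](_ : _ =
      (org e == y)%:R / edge_den e
      - (ter e == y)%:R * (u * c (org e) / edge_den e)); last first.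
    under eq_bigr => f _ do
      rewrite /backtrack_inv mulrBl -mulrA -mulrN -mulrA.
    by rewrite sum_backtrack orgV; ring.
  rewrite mulrBr; over.
rewrite sumrB; congr (_ - _).
  transitivity (u * \sum_(e | (ter e == x) && (org e == y)) w x / edge_den e).
    rewrite mulr_sumr [RHS]big_mkcond; apply: eq_bigr => e _.
    by case: eqP; case: eqP => //=; rewrite ?mul0r ?mulr0 ?mul0r // => *; ring.
  congr (_ * _); apply: sum_dart => e <- <-; rewrite /edge_den.
  by congr (_ / _); ring.
(* [weighted_D] sums over the arcs leaving x, the product over those entering
   x; reversing the arcs matches the two. *)
rewrite (reindex_inj (can_inj (@dart_invK G))) /=.
case: (altP (x =P y)) => [<-|xy].
  rewrite mulr_sumr [RHS]big_mkcond; apply: eq_bigr => e _.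
  rewrite edge_denV terV orgV /edge_den; case: eqP => [->|_] /=; first ring.
  by rewrite !mul0r.
rewrite mulr0 big1 // => e _; case: (altP (_ =P x)) => [->|]; rewrite ?mul0r //.
by rewrite (negPf xy) mul0r mulr0.
Qed.

Lemma det_weighted_walk (a : 'I_#|edge_set G| -> dart G) :
  orientation a -> (forall e, edge_den e != 0) ->
  \det (1%:M - u *: index_mx (fun e f : dart G =>
      (ter f == org e)%:R * w (org e) - (f == dart_inv e)%:R * c (org e))) =
    (\prod_(j < #|edge_set G|) edge_den (a j))
    * \det (1%:M - u *: weighted_A + u ^+ 2 *: weighted_D).
Proof.
move=> a_or den_neq0.
rewrite -(det_backtrack a_or) [X in _ * \det X]addrAC -[X in _ * \det X]addrA.
rewrite -[u ^+ 2 *: _ - _]opprB -backtrack_inv_vertex.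
rewrite -(det_sub_mulmx _ _ (mul_backtrack_inv den_neq0)).
congr (\det _); rewrite mul_fin_mx -fin_mx1; apply/matrixP => i j; rewrite !mxE.
move: (enum_val i) (enum_val j) => e f; rewrite /backtrack.
rewrite (bigD1 (org e)) //= eqxx big1 => [|x /negPf]; last first.
  by rewrite eq_sym => ->; rewrite mul0r.
by rewrite mul1r; ring.
Qed.

End WeightedWalk.

(** * The correlated random walk *)

Lemma ratfunC_is_zmod_morphism (R : numFieldType) : zmod_morphism (@ratfunC R).
Proof. by move=> x y; rewrite /ratfunC !rmorphB. Qed.

Lemma ratfunC_is_monoid_morphism (R : numFieldType) :
  monoid_morphism (@ratfunC R).
Proof. by split=> [|x y]; rewrite /ratfunC ?rmorphM ?rmorph1. Qed.

HB.instance Definition _ (R : numFieldType) :=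
  GRing.isZmodMorphism.Build R (ratfun R) (@ratfunC R)
    (@ratfunC_is_zmod_morphism R).
HB.instance Definition _ (R : numFieldType) :=
  GRing.isMonoidMorphism.Build R (ratfun R) (@ratfunC R)
    (@ratfunC_is_monoid_morphism R).

(** The constant coefficient of the polynomial 1 - X^2 c d is 1. *)
Lemma ratfun_den_neq0 (R : numFieldType) (c d : R) :
  1 - ratfunX R ^+ 2 * ratfunC c * ratfunC d != 0.
Proof.
rewrite -mulrA -rmorphM /ratfunC /ratfunX -tofracXn -tofracM -tofracB tofrac_eq0.
apply/eqP => /(congr1 (fun p : {poly R} => p`_0)); rewrite coefB coefMC coefXn.
by rewrite coef1 coef0 mul0r subr0 => /eqP; rewrite oner_eq0.
Qed.

(** The entries of the Grover matrix are real, so the squared modulus is an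
ordinary square, and (2/d - 1)^2 = 4/d^2 - (4/d - 1). *)
Lemma crw_mxE (R : numFieldType) (G : sgraph) :
  crw_mx R G = index_mx (fun e f : dart G =>
    (ter f == org e)%:R * (4 / (deg (org e))%:R ^+ 2)
    - (f == dart_inv e)%:R * (4 / (deg (org e))%:R - 1)).
Proof.
apply/matrixP => i j; rewrite !mxE.
move: (enum_val i) (enum_val j) => e f; rewrite /grover.
have [->|fe] := altP (f =P dart_inv e); last first.
  rewrite andbT mul0r subr0; case: eqP => [->|_];
    last by rewrite normr0 mul0r expr0n.
  by rewrite real_normK ?realM ?realV ?realn // mul1r -exprVn; ring.
rewrite terV eqxx /= real_normK ?realB ?realM ?realV ?realn ?real1 //.
by rewrite !mul1r -exprVn; ring.
Qed.

Theorem theorem4 (R : numFieldType) (G : sgraph)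
    (a : 'I_#|edge_set G| -> dart G) :
  connected_graph G -> orientation a ->
  let u : ratfun R := ratfunX R in
  \det (1%:M - u *: map_mx (@ratfunC R) (crw_mx R G)) =
    (\prod_(j < #|edge_set G|)
       (1 - u ^+ 2 * (4 / (deg (org (a j)))%:R - 1)
                   * (4 / (deg (ter (a j)))%:R - 1)))
    * \det (1%:M - u *: A_CRW G u + u ^+ 2 *: D_CRW G u).
Proof.
move=> _ a_or u.
pose c (x : G) : ratfun R := 4 / (deg x)%:R - 1.
pose w (x : G) : ratfun R := 4 / (deg x)%:R ^+ 2.
have cE x : c x = ratfunC (4 / (deg x)%:R - 1).
  by rewrite rmorphB rmorphM fmorphV !rmorph_nat rmorph1.
have wE x : w x = ratfunC (4 / (deg x)%:R ^+ 2).
  by rewrite rmorphM fmorphV rmorphXn !rmorph_nat.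
have den_neq0 e : edge_den u c e != 0.
  by rewrite /edge_den !cE; exact: ratfun_den_neq0.
rewrite -[RHS](det_weighted_walk w a_or den_neq0) crw_mxE.
congr (\det (_ - _ *: _)); apply/matrixP => i j; rewrite !mxE.
by rewrite cE wE rmorphB [X in X - _]rmorphM [X in _ - X]rmorphM !rmorph_nat.
Qed.
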